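(* Let $\mathcal{H}_A,\mathcal{H}_B$ be finite-dimensional complex Hilbert spaces, let $\rho_{AB}$ be a quantum state on $\mathcal{H}_A\otimes\mathcal{H}_B$, let $n\ge 1$ be an integer, and let $p_k=\operatorname{Tr}[(\rho_{AB}^{T_A})^k]$ for $k=1,2,\dots,n$. If $\rho_{AB}$ is separable, then the Hankel matrix $B_{\lfloor (n-1)/2\rfloor}(\boldsymbol{p})$ is positive semidefinite.
   Context: A quantum state on $\mathcal{H}_A\otimes\mathcal{H}_B$ is a positive semidefinite operator of trace one. It is separable if it is a convex combination of product states $\sigma_A\otimes\sigma_B$ (with $\sigma_A$, $\sigma_B$ quantum states on $\mathcal{H}_A$, $\mathcal{H}_B$). $\rho_{AB}^{T_A}$ denotes the partial transpose on $\mathcal{H}_A$ with respect to a fixed orthonormal basis, i.e. the linear map determined by $(X\otimes Y)^{T_A}=X^T\otimes Y$. For an integer $k\ge0$, $B_k(\boldsymbol{p})$ is the $(k+1)\times(k+1)$ matrix with entries $[B_k(\boldsymbol{p})]_{ij}=p_{i+j+1}$ for $i,j=0,1,\dots,k$. *)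

(* Defs.v *)
From HB Require Import structures.
From mathcomp Require Import all_boot all_order all_algebra.
From mathcomp Require Export reals complex mxtens.
Set Implicit Arguments.
Unset Strict Implicit.
Unset Printing Implicit Defensive.
Import Order.TTheory GRing.Theory Num.Theory.
Local Open Scope ring_scope.
Local Open Scope sesquilinear_scope.

(* A finite-dimensional complex Hilbert space with a fixed orthonormal basis is
   C^d, and its operators are the matrices 'M[C]_d.  The tensor product of the
   spaces of dimensions dA and dB is C^(dA * dB), with the product basis ordered
   by mxtens_index, so that tensmx is the tensor product of operators. *)
Notation "A *t B" := (tensmx A B)
  (at level 40, left associativity, format "A  *t  B") : ring_scope.

Section QuantumStates.
Variable C : numClosedFieldType.

(* For z : C, 0 <= z says that z is real and nonnegative. *)
Definition psdmx d (A : 'M[C]_d) : Prop :=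
  A \is hermsymmx /\ forall v : 'cV[C]_d, 0 <= (v^t* *m A *m v) 0 0.

Definition quantum_state d (rho : 'M[C]_d) : Prop :=
  psdmx rho /\ \tr rho = 1.

Definition separable dA dB (rho : 'M[C]_(dA * dB)) : Prop :=
  exists (m : nat) (w : 'I_m -> C)
         (sA : 'I_m -> 'M[C]_dA) (sB : 'I_m -> 'M[C]_dB),
    [/\ forall i, 0 <= w i,
        \sum_i w i = 1,
        forall i, quantum_state (sA i),
        forall i, quantum_state (sB i)
      & rho = \sum_i w i *: (sA i *t sB i)].

(* <i j| ptransA X |k l> = <k j| X |i l>.  By ptransA_is_linear, ptransA_tens
   and ptransA_unique below, this is the unique linear map sending X *t Y to
   X^T *t Y. *)
Definition ptransA dA dB (X : 'M[C]_(dA * dB)) : 'M[C]_(dA * dB) :=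
  \matrix_(x, y) X (mxtens_index ((mxtens_unindex y).1, (mxtens_unindex x).2))
                   (mxtens_index ((mxtens_unindex x).1, (mxtens_unindex y).2)).

Definition hankel_mx (p : nat -> C) (k : nat) : 'M[C]_k.+1 :=
  \matrix_(i, j) p (i + j + 1)%N.

Lemma ptransA_is_linear dA dB : linear (@ptransA dA dB).
Proof. by move=> a X Y; apply/matrixP=> x y; rewrite !mxE. Qed.

Lemma ptransA_tens dA dB (X : 'M[C]_dA) (Y : 'M[C]_dB) :
  ptransA (X *t Y) = X^T *t Y.
Proof. by apply/matrixP=> x y; rewrite !mxE !mxtens_indexK. Qed.

Lemma ptransA_unique dA dB (f : {linear 'M[C]_(dA * dB) -> 'M[C]_(dA * dB)}) :
  (forall (X : 'M[C]_dA) (Y : 'M[C]_dB), f (X *t Y) = X^T *t Y) ->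
  f =1 @ptransA dA dB.
Proof.
pose g := GRing.isLinear.Build _ _ _ _ _ (@ptransA_is_linear dA dB).
pose h : {linear _ -> _} := HB.pack (@ptransA dA dB) g.
move=> fE X; rewrite -[RHS]/(h X) (matrix_sum_delta X) !linear_sum.
apply: eq_bigr => x _; rewrite !linear_sum; apply: eq_bigr => y _.
rewrite !linearZ; congr (_ *: _).
case: (mxtens_indexP x) => i j; case: (mxtens_indexP y) => k l.
have -> : delta_mx (mxtens_index (i, j)) (mxtens_index (k, l))
        = delta_mx i k *t delta_mx j l :> 'M[C]_(dA * dB).
  apply/matrixP=> u v.
  case: (mxtens_indexP u) => u1 u2; case: (mxtens_indexP v) => v1 v2.
  rewrite tensmxE !mxE !(inj_eq (can_inj (@mxtens_indexK _ _))) !xpair_eqE.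
  by rewrite -natrM mulnb andbACA.
by rewrite fE /= ptransA_tens.
Qed.

End QuantumStates.

(* Main.v *)
(** Write positive semidefinite matrices as Gram matrices [P^t* *m P].  This form
    is stable under transposition and tensor products, so if [rho] is separable,
    its partial transpose [M], a convex combination of the [sA i^T *t sB i], is
    positive semidefinite.  Writing [M = P^t* *m P], the Hankel entry
    [\tr (M ^+ (i + j + 1))] equals [\tr ((P *m M ^+ i)^t* *m (P *m M ^+ j))]:
    the Hankel matrix is the Gram matrix of the [P *m M ^+ j] for the
    Hilbert-Schmidt inner product. *)
Require Import Defs.
From mathcomp Require Import all_boot all_order all_algebra.
Import Order.TTheory GRing.Theory Num.Theory.
Local Open Scope ring_scope.

Section PositiveSemidefinite.
Local Open Scope sesquilinear_scope.
Variable C : numClosedFieldType.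

Lemma trmxC_mul m n p (A : 'M[C]_(m, n)) (B : 'M[C]_(n, p)) :
  (A *m B)^t* = B^t* *m A^t*.
Proof. by rewrite trmx_mul map_mxM. Qed.

Lemma trmxC_tens m n p q (A : 'M[C]_(m, n)) (B : 'M[C]_(p, q)) :
  (A *t B)^t* = A^t* *t B^t*.
Proof. by rewrite trmx_tens map_mxT. Qed.

Lemma hermsymmxP n (A : 'M[C]_n) : reflect (A^t* = A) (A \is hermsymmx).
Proof.
by apply: (iffP (is_hermitianmxP _ _ _)); rewrite expr0 scale1r => /esym.
Qed.

Lemma gram_ge0 m n (A : 'M[C]_(m, n)) i : 0 <= (A^t* *m A) i i.
Proof.
by rewrite mxE sumr_ge0 // => k _; rewrite !mxE mulrC mul_conjC_ge0.
Qed.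

Lemma psdmx_gram m n (P : 'M[C]_(m, n)) : psdmx (P^t* *m P).
Proof.
split=> [|v]; first by apply/hermsymmxP; rewrite trmxC_mul trmxCK.
by rewrite mulmxA -mulmxA -trmxC_mul gram_ge0.
Qed.

(** By the spectral theorem [A] is unitarily diagonalizable; its eigenvalues are nonnegative, so
    their square roots give a factor [P]. *)
Lemma psdmx_gramP n (A : 'M[C]_n) :
  psdmx A -> exists P : 'M[C]_n, A = P^t* *m P.
Proof.
move=> [Aherm Apos]; set U := spectralmx A; set d := spectral_diag A.
have Uu : U \is unitarymx by apply: spectral_unitarymx.
have AE : A = U^t* *m diag_mx d *m U.
  rewrite -invmx_unitary //; apply/orthomx_spectralP.
  exact: hermitian_normalmx.
have d_ge0 i : 0 <= d 0 i.
  (* The test vector is the [i]-th eigenvector of [A], where the quadratic form takes the value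
     [d 0 i]. *)
  have := Apos (U^t* *m delta_mx i 0).
  rewrite trmxC_mul trmxCK AE !mulmxA !(mulmxtVK _ Uu).
  by rewrite -colE mxE trmx_delta map_delta_mx -rowE !mxE eqxx mulr1n.
exists (diag_mx (map_mx sqrtC d) *m U).
rewrite trmxC_mul -mulmxA (mulmxA _ _ U) tr_diag_mx map_diag_mx mulmx_diag.
rewrite mulmxA AE; congr (_ *m diag_mx _ *m _); apply/rowP=> i.
by rewrite !mxE /= geC0_conj ?sqrtC_ge0 // -expr2 sqrtCK.
Qed.

(** Transposing [P^t* *m P] gives [P^T] times the conjugate of [P], which is the Gram matrix of that
    conjugate. *)
Lemma psdmx_tr n (A : 'M[C]_n) : psdmx A -> psdmx A^T.
Proof.
move=> /psdmx_gramP[P ->].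
suff -> : (P^t* *m P)^T = (map_mx Num.conj P)^t* *m map_mx Num.conj P.
  exact: psdmx_gram.
by rewrite trmx_mul; congr (_ *m _); apply/matrixP=> i j; rewrite !mxE ?conjCK.
Qed.

Lemma psdmx_tens m n (A : 'M[C]_m) (B : 'M[C]_n) :
  psdmx A -> psdmx B -> psdmx (A *t B).
Proof.
move=> /psdmx_gramP[P ->] /psdmx_gramP[Q ->].
by rewrite -tensmx_mul -trmxC_tens; apply: psdmx_gram.
Qed.

Lemma psdmx_sum m n (w : 'I_m -> C) (A : 'I_m -> 'M[C]_n) :
  (forall i, 0 <= w i) -> (forall i, psdmx (A i)) ->
  psdmx (\sum_i w i *: A i).
Proof.
move=> w_ge0 Apsd; split=> [|v].
  apply/hermsymmxP; rewrite linear_sum raddf_sum; apply: eq_bigr => i _ /=.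
  rewrite linearZ map_mxZ /= (geC0_conj (w_ge0 i)).
  by have [/hermsymmxP-> _] := Apsd i.
rewrite mulmx_sumr mulmx_suml summxE sumr_ge0 // => i _.
rewrite -scalemxAr -scalemxAl mxE mulr_ge0 //.
by have [_] := Apsd i; apply.
Qed.

Lemma psdmx_ptransA dA dB (rho : 'M[C]_(dA * dB)) :
  separable rho -> psdmx (ptransA rho).
Proof.
move=> [m [w [sA [sB [w_ge0 _ sAstate sBstate ->]]]]].
have -> : ptransA (\sum_i w i *: (sA i *t sB i)) =
          \sum_i w i *: ((sA i)^T *t sB i).
  apply/matrixP=> x y; rewrite mxE !summxE; apply: eq_bigr => i _.
  by rewrite -ptransA_tens !mxE.
apply: psdmx_sum => // i.
by apply: psdmx_tens; [apply: psdmx_tr; case: (sAstate i) | case: (sBstate i)].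
Qed.

(** The range of [l] is exactly the set of indices occurring in [hankel_mx p k], so the lemma
    applies to a [p] that is known only up to a finite order. *)
Lemma psdmx_hankel n (M : 'M[C]_n) (p : nat -> C) k :
  psdmx M ->
  (forall l, (1 <= l <= k.*2.+1)%N -> p l = \tr (M ^+ l)) ->
  psdmx (hankel_mx p k).
Proof.
move=> Mpsd pE; have [/hermsymmxP Mherm _] := Mpsd.
have Mexp l : (M ^+ l)^t* = M ^+ l.
  elim: l => [|l IHl]; first by rewrite !expr0 trmx1 map_mx1.
  by rewrite {1}exprS exprSr -!mulmxE trmxC_mul IHl Mherm.
have [P MP] := psdmx_gramP _ _ Mpsd.
(* Flattening each [P *m M ^+ j] into a column turns Hilbert-Schmidt inner products into entries of
   [V^t* *m V]. *)
pose V := \matrix_(x < n * n, j < k.+1) mxvec (P *m M ^+ j) 0 x.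
suff -> : hankel_mx p k = V^t* *m V by apply: psdmx_gram.
apply/matrixP=> i j; rewrite !mxE pE; last first.
  by rewrite addn1 !ltnS -addnn leq_add // -ltnS.
(* The inner product [P^t* *m P] is one copy of [M], which accounts for the shift by 1 in the Hankel
   index. *)
have -> : M ^+ (i + j + 1) = (P *m M ^+ i)^t* *m (P *m M ^+ j).
  rewrite trmxC_mul Mexp mulmxA -(mulmxA _ _ P) -MP !mulmxE.
  by rewrite -exprSr -exprD addSn addn1.
transitivity (\sum_x \sum_y ((P *m M ^+ i) x y)^* * (P *m M ^+ j) x y).
  (* Cycling the trace makes the outer sum run over rows, the order of the double sum on the
     right. *)
  rewrite mxtrace_mulC; apply: eq_bigr => x _; rewrite mxE.
  by apply: eq_bigr => y _; rewrite mulrC 2!mxE.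
rewrite pair_bigA (reindex _ (curry_mxvec_bij _ _)).
by apply: eq_bigr => -[x y] _; symmetry; rewrite 4!mxE !mxvecE.
Qed.

End PositiveSemidefinite.

Theorem theorem2 (R : realType) (dA dB : nat)
    (rho : 'M[R[i]]_(dA * dB)) (n : nat) (p : nat -> R[i])
    (hrho : quantum_state rho)
    (hn : (1 <= n)%N)
    (hp : forall k : nat, (1 <= k <= n)%N -> p k = \tr (ptransA rho ^+ k))
    (hsep : separable rho) :
  psdmx (hankel_mx p ((n - 1) %/ 2)).
Proof.
apply: psdmx_hankel (psdmx_ptransA _ _ _ _ hsep) _ => k /andP[k_gt0 k_le].
apply: hp; rewrite k_gt0 (leq_trans k_le) //.
(* The largest index is twice the floor of (n - 1)/2, plus 1; it is at most (n - 1) + 1, which is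
   [n] because [n] is positive. *)
by rewrite -muln2 (leq_ltn_trans (leq_trunc_div _ _)) // subn1 prednK.
Qed.
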